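(* Let $r\ge1$. For $j\ge 0$, $k\ge 1$ and $n\ge 0$, the number of overpartitions $\pi$ of $n$ such that $mes(\pi;r)=k$ and exactly $j$ parts of $\pi$ have size greater than $k$ equals the number of overpartitions $\lambda$ of $n$ such that the largest $(r+1)$-repeating size of $\lambda$ is $j$ and exactly $k-1$ parts of $\lambda$ have size greater than $j$.
   Context: An overpartition of $n$ is a partition of $n$ in which the last occurrence of each distinct part value may be overlined. A part equal to $t$ or $\overline t$ has size $t$. For an overpartition $\pi$, $mes(\pi;r)$ is the smallest positive integer $t$ such that $\pi$ has no parts of size $t,t+1,\ldots,t+r-1$. A positive integer $j$ is an $(r+1)$-repeating size of $\pi$ if $\pi$ has at least $r+1$ parts of size $j$; by convention $0$ is always an $(r+1)$-repeating size of $\pi$. *)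

(* Defs.v *)
From HB Require Import structures.
From mathcomp Require Import all_boot.

Set Implicit Arguments.
Unset Strict Implicit.
Unset Printing Implicit Defensive.

(* A part is a pair (size, overlined). *)
Definition part : Type := nat * bool.

(* [follows a b]: part [b] may come right after part [a]. Sizes are weakly
   decreasing, and an overlined part must be the last occurrence of its size,
   i.e. the next part has a strictly smaller size. *)
Definition follows (a b : part) : bool :=
  if a.2 then b.1 < a.1 else b.1 <= a.1.

Definition sizes (s : seq part) : seq nat := [seq a.1 | a <- s].

Definition is_overpartition (n : nat) (s : seq part) : bool :=
  [&& sorted follows s, all (fun t => 0 < t) (sizes s) & sumn (sizes s) == n].

Record overpartition (n : nat) := Overpartition {
  parts :> seq part;
  partsP : is_overpartition n parts
}.

HB.instance Definition _ n := [isSub for @parts n].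
HB.instance Definition _ n := [Countable of overpartition n by <:].

Lemma mem_leq_sumn (s : seq nat) t : t \in s -> t <= sumn s.
Proof.
elim: s => //= a s IHs; rewrite inE => /predU1P [->|/IHs]; first exact: leq_addr.
by move=> /leq_trans; apply; apply: leq_addl.
Qed.

Section OverpartitionFinite.

Variable n : nat.

Let boundedParts : Type := {k : 'I_n.+1 & k.-tuple ('I_n.+1 * bool)%type}.

Let unbound (x : boundedParts) : seq part :=
  [seq (val a.1, a.2) | a <- tval (tagged x)].

Let unpack (x : boundedParts) : option (overpartition n) := insub (unbound x).

Lemma overpartition_bounded (p : overpartition n) :
  size p <= n /\ all (fun t => t <= n) (sizes p).
Proof.
case/and3P: (partsP p) => _ pos /eqP sum_p; split; last first.
  by apply/allP => t /mem_leq_sumn; rewrite sum_p.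
rewrite -[size p](size_map (@fst nat bool)) -/(sizes p) -[X in _ <= X]sum_p.
elim: (sizes p) pos => //= t s IHs /andP[t_gt0 /IHs le_s].
by rewrite -add1n leq_add.
Qed.

Let pack (p : overpartition n) : boundedParts :=
  Tagged (fun k : 'I_n.+1 => k.-tuple ('I_n.+1 * bool)%type)
    (i := Ordinal (proj1 (overpartition_bounded p) : size p < n.+1))
    (map_tuple (fun a : part => (inord a.1 : 'I_n.+1, a.2)) (in_tuple p)).

Let packK : pcancel pack unpack.
Proof.
move=> p; have -> : unpack (pack p) = insub (parts p); last exact: valK.
congr insub; rewrite /unbound /= -map_comp -[RHS]map_id.
apply/eq_in_map => -[t o] p_t /=; rewrite inordK // ltnS.
by case: (overpartition_bounded p) => _ /allP; apply; apply: map_f p_t.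
Qed.

HB.instance Definition _ : isFinite (overpartition n) := PCanIsFinite packK.

End OverpartitionFinite.

Definition nparts_gt (s : seq part) (k : nat) : nat :=
  count (fun t => k < t) (sizes s).

Definition gap (r : nat) (s : seq part) (t : nat) : bool :=
  (0 < t) && all (fun u => u \notin sizes s) (iota t r).

Lemma gap_exists r s : exists t, gap r s t.
Proof.
exists (sumn (sizes s)).+1; rewrite /gap /=; apply/allP => u.
rewrite mem_iota => /andP[lt_u _]; apply/negP => /mem_leq_sumn.
by rewrite leqNgt lt_u.
Qed.

Definition mes (s : seq part) (r : nat) : nat := ex_minn (gap_exists r s).

(* The argument [r] stands for (r+1)-repetition. *)
Definition repeating_size (r : nat) (s : seq part) (j : nat) : bool :=
  (j == 0) || (r.+1 <= count_mem j (sizes s)).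

Lemma repeating_size_exists r s : exists j, repeating_size r s j.
Proof. by exists 0. Qed.

Lemma repeating_size_bounded r s j :
  repeating_size r s j -> j <= sumn (sizes s).
Proof.
case/predU1P => [-> //|/(leq_ltn_trans (leq0n r))].
by rewrite -has_count has_pred1; apply: mem_leq_sumn.
Qed.

Definition largest_repeating_size (r : nat) (s : seq part) : nat :=
  ex_maxn (repeating_size_exists r s) (@repeating_size_bounded r s).

(* Main.v *)
Require Import Defs.
From mathcomp Require Import all_boot zify.

(** Conjugation of overpartitions: an overlined last part of size [t] marks a
    corner of the Ferrers diagram, and transposing the diagram keeps the marked
    corners.  Let [L i] be the number of parts of size greater than [i], i.e. the
    [i.+1]-st part of the conjugate.  The sizes [t, ..., t + r - 1] are absent iff
    [L (t - 1) = L (t + r - 1)], i.e. iff the parts number [t, ..., t + r] of the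
    conjugate are equal; the smallest such [t] yields the largest
    [r + 1]-repeating size. *)

Lemma follows_trans : transitive follows.
Proof. by move=> [b []] [a []] [c []]; rewrite /follows /=; lia. Qed.

Lemma follows_anti : antisymmetric follows.
Proof.
move=> [a oa] [b ob]; rewrite /follows /=.
by case: oa; case: ob => ?; [lia | lia | lia | congr (_, _); lia].
Qed.

Lemma sorted_sizes s : sorted follows s -> sorted geq (sizes s).
Proof.
move=> s_sorted; rewrite sorted_map; apply: sub_sorted s_sorted => a b.
by rewrite /follows /=; case: a.2 => // /ltnW.
Qed.

(** By transitivity an overlined part is strictly larger than everything after it, so it cannot
    recur. *)
Lemma count_overlined s t :
  sorted follows s -> count_mem (t, true) s = ((t, true) \in s).
Proof.
elim: s => //= a s IHs s_path; rewrite IHs ?(path_sorted s_path) // inE.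
rewrite eq_sym; case: eqVneq => //= a_t.
have /allP a_min := order_path_min follows_trans s_path.
case: (boolP (_ \in s)) => // /a_min.
by rewrite -a_t /follows /= ltnn.
Qed.

Lemma count_size s t :
  count_mem t (sizes s) = count_mem (t, true) s + count_mem (t, false) s.
Proof.
elim: s => //= -[u o] s ->; rewrite !xpair_eqE /=.
by case: o; case: (u == t) => /=; lia.
Qed.

Lemma sum_ltn_nat M t : t <= M -> \sum_(0 <= i < M) (i < t : nat) = t.
Proof.
move=> le_tM; rewrite (big_cat_nat (n := t)) //=.
rewrite [X in _ + X]big1_seq ?addn0 => [|i]; last first.
  by rewrite mem_index_iota => /and3P[_ le_ti _]; rewrite ltnNge le_ti.
rewrite -[RHS]subn0 -[RHS]muln1 -sum_nat_const_nat.
by apply: eq_big_nat => i /andP[_ ->].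
Qed.

(** The entries exceeding [j] form a prefix of a weakly decreasing list. *)
Lemma ltn_count_gtn (s : seq nat) i j :
  sorted geq s -> (i < count (fun t => j < t) s) = (j < nth 0 s i).
Proof.
elim: s i => [|a s IHs] i /=; first by rewrite nth_nil.
move=> s_path; have /IHs {}IHs := path_sorted s_path.
have geq_trans : transitive geq by move=> x y z /= ? ?; lia.
have /allP a_min := order_path_min geq_trans s_path.
case: (ltnP j a) => [lt_ja | le_aj] /=; first by case: i => [|i] //=; rewrite ltnS.
rewrite add0n -[RHS]negbK -leqNgt.
have /eqP -> : count (fun t => j < t) s == 0.
  rewrite -leqn0 leqNgt -has_count; apply/hasPn => t /a_min /= ?; lia.
case: i => [|i] /=; first by rewrite le_aj.
case: (ltnP i (size s)) => [lt_i | ge_i]; last by rewrite nth_default.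
by have /a_min /= ? := mem_nth 0 lt_i; lia.
Qed.

Section NumberOfParts.

Variable s : seq part.

Lemma nparts_gt_anti i j : i <= j -> nparts_gt s j <= nparts_gt s i.
Proof. by move=> le_ij; apply: sub_count => t /=; apply: leq_ltn_trans. Qed.

Lemma nparts_gtS t :
  nparts_gt s t = count_mem t.+1 (sizes s) + nparts_gt s t.+1.
Proof.
rewrite /nparts_gt; elim: (sizes s) => //= a l ->.
by case: eqVneq => ?; lia.
Qed.

(** The right-hand counts differ by the number of parts with size in [t + 1, ..., t + r]. *)
Lemma gapE r t : gap r s t.+1 = (nparts_gt s t == nparts_gt s (t + r)).
Proof.
rewrite /gap /=; elim: r t => [|r IHr] t; first by rewrite addn0 eqxx.
rewrite /= IHr addSnnS -has_pred1 has_count (nparts_gtS t).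
have := @nparts_gt_anti t.+1 (t + r.+1); lia.
Qed.

Lemma repeating_sizeS r j :
  repeating_size r s j.+1 = (nparts_gt s j.+1 + r < nparts_gt s j).
Proof. by rewrite /repeating_size (nparts_gtS j) addnC ltn_add2r. Qed.

Lemma mes_nparts_gt r : exists t, [/\ mes s r = t.+1,
  nparts_gt s t = nparts_gt s (t + r) &
  forall u, nparts_gt s u = nparts_gt s (u + r) -> t <= u].
Proof.
rewrite /mes; case: ex_minnP => -[|t]; first by rewrite /gap.
rewrite gapE => /eqP gap_t t_min; exists t; split=> // u /eqP.
by rewrite -gapE => /t_min.
Qed.

End NumberOfParts.

(* The [i.+1]-st part is overlined iff the size [i.+1] is overlined in [s]: it is
   the last one of its size iff [i.+1] is the size of some part of [s]. *)
Definition conjugate (s : seq part) : seq part :=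
  [seq (nparts_gt s i, (i.+1, true) \in s) | i <- iota 0 (\max_(t <- sizes s) t)].

Section Conjugate.

Variable s : seq part.

Lemma nparts_gt_gt0 i : (0 < nparts_gt s i) = (i < \max_(t <- sizes s) t).
Proof.
rewrite /nparts_gt -has_count; apply/idP/idP => [/hasP[t t_s lt_it] | ].
  exact/(leq_trans lt_it)/leq_bigmax_seq.
apply: contraTT => /hasPn no_part; rewrite -leqNgt.
by apply/bigmax_leqP_seq => t t_s _; rewrite leqNgt; apply: no_part.
Qed.

(** The default [(0, false)] is the correct value past the end: no part there exceeds [i], and none
    of size [i.+1] is overlined. So [i] is unrestricted. *)
Lemma nth_conjugate i :
  nth (0, false) (conjugate s) i = (nparts_gt s i, (i.+1, true) \in s).
Proof.
case: (ltnP i (\max_(t <- sizes s) t)) => [lt_i | ge_i].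
  by rewrite (nth_map 0) ?size_iota // nth_iota.
rewrite nth_default ?size_map ?size_iota //.
have /eqP nparts0 : nparts_gt s i == 0 by rewrite -leqn0 leqNgt nparts_gt_gt0 -leqNgt.
rewrite nparts0; case: (boolP (_ \in s)) => // /(map_f fst) i_s.
suff : 0 < nparts_gt s i by rewrite nparts0.
by rewrite /nparts_gt -has_count; apply/hasP; exists i.+1.
Qed.

Lemma sorted_conjugate : sorted follows (conjugate s).
Proof.
apply/(sortedP (0, false)) => i _; rewrite !nth_conjugate /follows /= (nparts_gtS s i).
case: ifP => [/(map_f fst) i_s | _]; last exact: leq_addl.
by rewrite -add1n leq_add2r -has_count has_pred1.
Qed.

Lemma sumn_conjugate : sumn (sizes (conjugate s)) = sumn (sizes s).
Proof.
rewrite /conjugate; set M := \max_(t <- sizes s) t.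
rewrite {1 2}/sizes -map_comp !sumnE !big_map /=.
have -> : iota 0 M = index_iota 0 M by rewrite /index_iota subn0.
(* Double counting of the cells of the Ferrers diagram, by columns and then by rows. *)
transitivity (\sum_(0 <= i < M) \sum_(a <- s) (i < a.1 : nat)).
  apply: eq_bigr => i _; rewrite /nparts_gt /sizes count_map -sum1_count big_mkcond.
  by apply: eq_bigr => a _ /=; case: ltnP.
rewrite exchange_big /=; apply: eq_big_seq => a a_s; apply: sum_ltn_nat.
by apply: leq_bigmax_seq => //; apply: map_f a_s.
Qed.

Lemma conjugate_overpartition n :
  is_overpartition n s -> is_overpartition n (conjugate s).
Proof.
case/and3P => _ _ sum_s; apply/and3P; split; first exact: sorted_conjugate.
  apply/allP => _ /mapP[_ /mapP[i i_lt ->] ->] /=.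
  by rewrite nparts_gt_gt0; move: i_lt; rewrite mem_iota.
by rewrite sumn_conjugate.
Qed.

(** Both sides say that one cell lies in the diagram, read before and after transposition. *)
Lemma ltn_nparts_gt_conjugate i j :
  (i < nparts_gt (conjugate s) j) = (j < nparts_gt s i).
Proof.
rewrite [X in i < X]/nparts_gt ltn_count_gtn; last exact/sorted_sizes/sorted_conjugate.
case: (ltnP i (size (conjugate s))) => [lt_i | ge_i].
  by rewrite (nth_map (0, false)) // nth_conjugate.
have := nth_conjugate i; rewrite nth_default // => -[<- _].
by rewrite nth_default // size_map.
Qed.

(** As [r] is positive, the size [mes s r] itself is absent. *)
Lemma nparts_gt_mes r : 0 < r -> nparts_gt s (mes s r) = nparts_gt s (mes s r).-1.
Proof.
case: (mes_nparts_gt s r) => t [-> gap_t _] r_gt0 /=.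
by have := @nparts_gt_anti s t t.+1; have := @nparts_gt_anti s t.+1 (t + r); lia.
Qed.

Lemma nparts_gt_conjugate_mes r :
  nparts_gt (conjugate s) (nparts_gt s (mes s r).-1) = (mes s r).-1.
Proof.
case: (mes_nparts_gt s r) => t [-> gap_t t_min] /=; set J := nparts_gt s t.
have {}gap_t : nparts_gt s (t + r) = J by [].
apply/eqP; rewrite eqn_leq leqNgt ltn_nparts_gt_conjugate ltnn /=.
case: t @J gap_t t_min => // t J gap_t t_min.
(* Otherwise [nparts_gt s] is constant from [t] to [t.+1 + r], and a gap starts one size earlier. *)
rewrite ltn_nparts_gt_conjugate ltnNge; apply/negP => le_J.
suff /t_min : nparts_gt s t = nparts_gt s (t + r) by rewrite ltnn.
have := @nparts_gt_anti s t (t + r); have := @nparts_gt_anti s (t + r) (t.+1 + r); lia.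
Qed.

Lemma largest_repeating_size_conjugate r :
  largest_repeating_size r (conjugate s) = nparts_gt s (mes s r).-1.
Proof.
have := nparts_gt_conjugate_mes r.
case: (mes_nparts_gt s r) => t [-> gap_t t_min] /= conj_t.
rewrite /largest_repeating_size; case: ex_maxnP => j rep_j j_max.
apply/eqP; rewrite eqn_leq; apply/andP; split.
  case: j rep_j {j_max} => // j; rewrite repeating_sizeS ltn_nparts_gt_conjugate.
  (* Here [j < nparts_gt s (u + r) <= nparts_gt s u <= j.+1], so a gap starts at [u.+1]; minimality
     gives [t <= u], which bounds [j.+1] by [nparts_gt s t]. *)
  set u := nparts_gt (conjugate s) _ => lt_j.
  have le_u : nparts_gt s u <= j.+1 by rewrite leqNgt -ltn_nparts_gt_conjugate ltnn.
  have le_tu : t <= u by apply: t_min; have := @nparts_gt_anti s u (u + r); lia.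
  by have := @nparts_gt_anti s t u; have := @nparts_gt_anti s u (u + r); lia.
(* The bound is attained: the value 0 repeats by convention, and for [J.+1] the gap equality is
   exactly the repetition condition. *)
apply: j_max; case def_J: (nparts_gt s t) => [|J] //.
by rewrite repeating_sizeS -def_J conj_t ltn_nparts_gt_conjugate -gap_t def_J.
Qed.

End Conjugate.

(** The entries of the conjugate determine every [nparts_gt] and every overline, hence the
    multiplicity of each part; a sorted list is determined by its multiplicities. *)
Lemma conjugate_inj n s1 s2 :
    is_overpartition n s1 -> is_overpartition n s2 ->
  conjugate s1 = conjugate s2 -> s1 = s2.
Proof.
case/and3P=> sorted1 pos1 _ /and3P[sorted2 pos2 _] eq_conj.
have nth_eq i := congr1 (fun s => nth (0, false) s i) eq_conj.
have eq_nparts i : nparts_gt s1 i = nparts_gt s2 i.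
  by move: (nth_eq i); rewrite !nth_conjugate => -[].
have eq_over i : ((i.+1, true) \in s1) = ((i.+1, true) \in s2).
  by move: (nth_eq i); rewrite !nth_conjugate => -[].
apply: (sorted_eq follows_trans follows_anti) => //.
apply/allP => -[[|t] o] _ /=.
  have no_zero s : all (fun u => 0 < u) (sizes s) -> count_mem (0, o) s = 0.
    move/allP => pos; apply/count_memPn/negP => /(map_f fst) /pos //.
  by rewrite !no_zero.
have := nparts_gtS s1 t; rewrite !eq_nparts (nparts_gtS s2 t) !count_size.
rewrite !count_overlined // eq_over.
case: o; first by rewrite !count_overlined // eq_over.
by move/addIn/addnI => ->.
Qed.

Definition conjugate_op n (p : overpartition n) : overpartition n :=
  Overpartition (conjugate_overpartition p n (partsP p)).

Lemma conjugate_op_inj n : injective (@conjugate_op n).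
Proof.
move=> p q /(congr1 (@parts n)) /= /conjugate_inj eq_pq.
by apply: val_inj; apply: eq_pq; apply: partsP.
Qed.

Theorem theorem2p1 (r : nat) (hr : 1 <= r) (j k n : nat) (hk : 1 <= k) :
  #|[set p : overpartition n | (mes p r == k) && (nparts_gt p k == j)]| =
  #|[set l : overpartition n |
      (largest_repeating_size r l == j) && (nparts_gt l j == k - 1)]|.
Proof.
(* An injective self-map of a finite type is a bijection, so preimages keep their cardinality. *)
rewrite -[RHS](card_preimset _ (conjugate_op_inj n)).
apply: eq_card => p; rewrite !inE /= largest_repeating_size_conjugate.
(* [mes_t] records that [mes p r] is positive, so that equal predecessors give [mes p r = k] at the
   end. *)
rewrite -nparts_gt_mes //; have [t [mes_t _ _]] := mes_nparts_gt p r.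
apply/andP/andP => [[/eqP <- /eqP <-] | [/eqP <-]].
  by rewrite [X in nparts_gt (conjugate p) X]nparts_gt_mes // nparts_gt_conjugate_mes subn1.
rewrite [X in nparts_gt (conjugate p) X]nparts_gt_mes // nparts_gt_conjugate_mes.
by move=> /eqP eq_k; have <- : mes p r = k by lia.
Qed.
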